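(* Let $X\in\mathbb R^{n\times p}$ be fixed, $\beta^0\in\mathbb R^p$ with active set $S_0$, $s_0=|S_0|$, and let $\lambda^*>0$. Suppose $\hat\kappa^2(S_0)>0$. Let $$b^*\in\arg\min_{b\in\mathbb R^p}\left\{\|Xb\|_2:\ \|b_{S_0}\|_1-\|b_{-S_0}\|_1=1\right\}$$ and for $j\in S_0$ let $z_j^*$ be the sign of $b_j^*$. Suppose that $\beta^0$ satisfies the betamin condition $$z_j^*\beta_j^0>\frac{z_j^*b_j^*s_0}{\hat\kappa^2(S_0)}\,\frac{\lambda^*}{n}\qquad\text{for all } j\in S_0 .$$ Then there exists a solution $\beta^*$ of the KKT conditions $$X^TX(\beta^*-\beta^0)+\lambda^*\zeta^*=0,\qquad\zeta^*\in\partial\|\beta^*\|_1,$$ such that $$\|X(\beta^*-\beta^0)\|_2^2=\frac{s_0}{\hat\kappa^2(S_0)}\,\frac{\lambda^{*2}}{n}.$$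
   Context: $S_0:=\{j:\beta_j^0\neq0\}$ (nonempty). For $b\in\mathbb R^p$ and $S\subset\{1,\dots,p\}$, $b_S$ is the vector with entries $b_j1\{j\in S\}$ and $b_{-S}:=b_{S^c}$. The empirical compatibility constant is $\hat\kappa^2(S):=\min\{|S|\,\|Xb\|_2^2/n:\ \|b_S\|_1-\|b_{-S}\|_1=1\}$. The sub-differential is $\partial\|b\|_1=\{z\in\mathbb R^p:\ z^Tb=\|b\|_1,\ \|z\|_\infty\le1\}$. The displayed KKT conditions are those of the noiseless Lasso problem $\min_b\{\|X(b-\beta^0)\|_2^2+2\lambda^*\|b\|_1\}$. *)

(* Defs.v *)
From mathcomp Require Import all_boot all_order all_algebra.
From mathcomp Require Import all_classical all_reals all_analysis.

Set Implicit Arguments.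
Unset Strict Implicit.
Unset Printing Implicit Defensive.

Import Order.TTheory GRing.Theory Num.Theory.
Local Open Scope classical_set_scope.
Local Open Scope ring_scope.

Definition l1norm (R : realType) (p : nat) (b : 'cV[R]_p) : R :=
  \sum_(j < p) `|b j 0|.

Definition l2norm (R : realType) (n : nat) (v : 'cV[R]_n) : R :=
  Num.sqrt (\sum_(i < n) v i 0 ^+ 2).

(* b_S, kept as a vector of length p; b_{-S} is [restr b (~: S)]. *)
Definition restr (R : realType) (p : nat) (b : 'cV[R]_p) (S : {set 'I_p}) :
  'cV[R]_p := \col_j (if j \in S then b j 0 else 0).

Definition active_set (R : realType) (p : nat) (b : 'cV[R]_p) : {set 'I_p} :=
  [set j | b j 0 != 0]%SET.

Definition argmin (R : realType) (T : Type) (f : T -> R) (A : set T) : set T :=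
  [set x | A x /\ forall y, A y -> f x <= f y].

(* The constraint || b_S ||_1 - || b_{-S} ||_1 = 1 *)
Definition compat_set (R : realType) (p : nat) (S : {set 'I_p}) :
  set 'cV[R]_p :=
  [set b | l1norm (restr b S) - l1norm (restr b (~: S)%SET) = 1].

Definition compat_obj (R : realType) (n p : nat) (X : 'M[R]_(n, p))
  (S : {set 'I_p}) (b : 'cV[R]_p) : R :=
  #|S|%:R * l2norm (X *m b) ^+ 2 / n%:R.

(* The squared compatibility constant.  The minimum is taken as an infimum,
   with which it coincides whenever a minimizer exists (compat2_argmin below);
   [inf set0 = 0], so positivity forces the constraint to be feasible, hence
   S to be nonempty, and n to be nonzero. *)
Definition compat2 (R : realType) (n p : nat) (X : 'M[R]_(n, p))
  (S : {set 'I_p}) : R := inf (compat_obj X S @` compat_set S).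

(* [mx_norm] is the sup norm of the entries. *)
Definition subdiff_l1 (R : realType) (p : nat) (b : 'cV[R]_p) :
  set 'cV[R]_p :=
  [set z | (z^T *m b) 0 0 = l1norm b /\ mx_norm z <= 1].

Lemma compat2_argmin (R : realType) (n p : nat) (X : 'M[R]_(n, p))
    (S : {set 'I_p}) (b : 'cV[R]_p) :
  argmin (compat_obj X S) (compat_set S) b ->
  compat2 X S = compat_obj X S b.
Proof.
move=> [Ab min_b]; apply/eqP; rewrite eq_le; apply/andP; split.
  apply: ge_inf; last by exists b.
  by exists (compat_obj X S b) => _ [y Ay <-]; exact: min_b.
apply: lb_le_inf; first by exists (compat_obj X S b), b.
by move=> _ [y Ay <-]; exact: min_b.
Qed.

(* Main.v *)
(* Put m = |X b*|^2 and g(b) = |b_S0|_1 - |b_{-S0}|_1.  By homogeneity b*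
   satisfies |X b|^2 >= m g(b)^2 whenever g(b) >= 0, with equality at b*.
   Perturbing b* along coordinate j shows that zeta* = X^T X b* / m has entry
   z*_j for j in S0, and lies in -d|.| (b*_j) for j outside S0.  Then
   beta* = beta0 - (lambda/m) b* solves the KKT conditions with this zeta*:
   the betamin condition forces b*_j <> 0 on S0 and gives beta*_j the sign z*_j
   there, while off S0 beta*_j = - (lambda/m) b*_j. *)
Require Import Defs.
From mathcomp Require Import all_boot all_order all_algebra.
From mathcomp Require Import all_classical all_reals all_analysis.
From mathcomp Require Import ring lra.

Set Implicit Arguments.
Unset Strict Implicit.
Unset Printing Implicit Defensive.

Import Order.TTheory GRing.Theory Num.Theory.
Local Open Scope classical_set_scope.
Local Open Scope ring_scope.

Lemma sqr_l2norm (R : realType) (n : nat) (v : 'cV[R]_n) :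
  l2norm v ^+ 2 = (v^T *m v) 0 0.
Proof.
rewrite sqr_sqrtr; last by apply: sumr_ge0 => i _; exact: sqr_ge0.
by rewrite mxE; apply: eq_bigr => i _; rewrite mxE expr2.
Qed.

Lemma sqr_l2normZ (R : realType) (n : nat) (a : R) (v : 'cV[R]_n) :
  l2norm (a *: v) ^+ 2 = a ^+ 2 * l2norm v ^+ 2.
Proof.
by rewrite !sqr_l2norm -scalemxAr [(a *: v)^T]linearZ /= -scalemxAl scalerA mxE.
Qed.

Lemma sqr_l2normD (R : realType) (n : nat) (u v : 'cV[R]_n) :
  l2norm (u + v) ^+ 2
  = l2norm u ^+ 2 + (u^T *m v) 0 0 *+ 2 + l2norm v ^+ 2.
Proof.
rewrite !sqr_l2norm [(u + v)^T]linearD /= mulmxDl !mulmxDr !mxE mulr2n !addrA.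
congr (_ + _ + _ + _).
by apply: eq_bigr => i _; rewrite !mxE mulrC.
Qed.

(** The constraint functional of [compat_set], named so that it can be evaluated off its level set
    1. *)
Definition l1gap (R : realType) (p : nat) (S : {set 'I_p}) (b : 'cV[R]_p) : R :=
  l1norm (restr b S) - l1norm (restr b (~: S)%SET).

Lemma l1gapE (R : realType) (p : nat) (S : {set 'I_p}) (b : 'cV[R]_p) :
  l1gap S b = \sum_j (if j \in S then `|b j 0| else - `|b j 0|).
Proof.
rewrite /l1gap /l1norm -sumrB; apply: eq_bigr => j _; rewrite !mxE inE.
by case: (j \in S); rewrite normr0 ?subr0 ?sub0r.
Qed.

Lemma l1gapZ (R : realType) (p : nat) (S : {set 'I_p}) (a : R) (b : 'cV[R]_p) :
  l1gap S (a *: b) = `|a| * l1gap S b.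
Proof.
rewrite !l1gapE mulr_sumr; apply: eq_bigr => j _; rewrite mxE normrM.
by case: ifP; rewrite ?mulrN.
Qed.

Lemma l1gap_coord (R : realType) (p : nat) (S : {set 'I_p}) (b : 'cV[R]_p)
    (j : 'I_p) (c : R) :
  l1gap S (b + c *: delta_mx j 0)
  = l1gap S b + (if j \in S then `|b j 0 + c| - `|b j 0|
                 else `|b j 0| - `|b j 0 + c|).
Proof.
rewrite !l1gapE (bigD1 j) //= [in RHS](bigD1 j) //= !mxE !eqxx mulr1.
have -> : \sum_(i < p | i != j)
      (if i \in S then `|(b + c *: delta_mx j 0) i 0|
       else - `|(b + c *: delta_mx j 0) i 0|)
    = \sum_(i < p | i != j) (if i \in S then `|b i 0| else - `|b i 0|).
  by apply: eq_bigr => i /negPf ij; rewrite !mxE ij mulr0 addr0.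
case: ifP => _; ring.
Qed.

(** Stands in for letting [x] tend to 0: if [a < 0], then [c > 0] is forced, and at
    [x = min(e, -a / (2c))] the value is at most [a / 2]. *)
Lemma linear_coeff_ge0 (R : realType) (a c e : R) : 0 < e ->
  (forall x, 0 < x -> x <= e -> 0 <= a + x * c) -> 0 <= a.
Proof.
move=> e0 H; rewrite leNgt; apply/negP => a0.
have [c0|c0] := leP c 0; first by have := H e e0 (lexx e); nra.
have x0 : 0 < Num.min e (- a / (2 * c)).
  by rewrite lt_min e0 /= divr_gt0 //; lra.
have := H _ x0; rewrite ge_min lexx /= => /(_ isT).
have : Num.min e (- a / (2 * c)) <= - a / (2 * c) by rewrite ge_min lexx orbT.
rewrite ler_pdivlMr; last by lra.
nra.
Qed.

Section Minimizer.
Variables (R : realType) (n p : nat) (X : 'M[R]_(n, p)) (S : {set 'I_p}).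
Variable b : 'cV[R]_p.
Hypothesis hb : argmin (fun b : 'cV[R]_p => l2norm (X *m b)) (compat_set S) b.

Let m := l2norm (X *m b) ^+ 2.

(** Squaring is monotone on nonnegative reals, so [b] also minimizes [compat_obj]. *)
Lemma compat2_minimizer : compat2 X S = #|S|%:R * m / n%:R.
Proof.
apply: compat2_argmin; case: hb => Ab hmin; split=> // y /hmin le_by.
rewrite /compat_obj ler_wpM2r ?invr_ge0// ler_wpM2l//.
by rewrite lerXn2r ?nnegrE ?sqrtr_ge0.
Qed.

(** For a positive gap, rescale [y] to gap 1 and compare with [b]. *)
Lemma minimizer_gap_le (y : 'cV[R]_p) : 0 <= l1gap S y ->
  m * l1gap S y ^+ 2 <= l2norm (X *m y) ^+ 2.
Proof.
rewrite le_eqVlt => /predU1P[<-|y0].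
  by rewrite expr0n mulr0 sqr_ge0.
have Cy : compat_set S ((l1gap S y)^-1 *: y).
  rewrite /compat_set /= -/(l1gap S _) l1gapZ gtr0_norm ?invr_gt0//.
  by rewrite mulVf ?gt_eqF.
have := hb.2 _ Cy; rewrite -ler_sqr ?nnegrE ?sqrtr_ge0//.
rewrite -scalemxAr sqr_l2normZ exprVn mulrC ler_pdivlMr ?exprn_gt0//.
Qed.

(* First-order optimality: the derivative of [|Xb|^2 - m (l1gap b)^2] along a
   direction is nonnegative, and [a] bounds that of [l1gap] from below. *)
Lemma minimizer_first_order (h : 'cV[R]_p) (a : R) :
  (forall e, 0 < e -> e <= 1 -> 1 + e * a <= l1gap S (b + e *: h)) ->
  m * a <= ((X *m b)^T *m (X *m h)) 0 0.
Proof.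
move=> H; rewrite -subr_ge0.
have m0 : 0 <= m by exact: sqr_ge0.
pose Q := l2norm (X *m h) ^+ 2.
have d0 : 0 < 2 * (1 + `|a|) by have := normr_ge0 a; lra.
(* With [B] the inner product of [X b] and [X h], the expansion of [|X(b + e h)|^2 - m (1 + e a)^2]
   is [2e (B - m a) + e^2 (Q - m a^2)]; divide by [2e]. The range of [e] ensures [e <= 1] and
   [1 + e a >= 0], so the bound on the gap may be squared. *)
apply: (@linear_coeff_ge0 _ _ ((Q - m * a ^+ 2) / 2) (2 * (1 + `|a|))^-1).
  by rewrite invr_gt0.
move=> e e0; rewrite -[e <= _]lef_pV2 ?posrE ?invr_gt0// invrK => ele.
have {ele} ele : 2 * (1 + `|a|) * e <= 1.
  by rewrite -ler_pdivlMr// div1r.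
have a0 := normr_ge0 a.
have ga : - `|a| <= a by rewrite lerNl -normrN ler_norm.
have e1 : e <= 1 by nra.
have g1 := H e e0 e1.
have ge0 : 0 <= 1 + e * a by nra.
have := minimizer_gap_le (le_trans ge0 g1).
rewrite mulmxDr sqr_l2normD -scalemxAr sqr_l2normZ -/m -/Q -scalemxAr mxE.
set B := (_ *m _) 0 0 => ineq.
have {}ineq : m * (1 + e * a) ^+ 2 <= m + (e * B) *+ 2 + e ^+ 2 * Q.
  by apply: le_trans ineq; rewrite ler_wpM2l// lerXn2r ?nnegrE// (le_trans ge0).
have : 0 <= e * (2 * (B - m * a + e * ((Q - m * a ^+ 2) / 2))).
  move: ineq; rewrite -subr_ge0 => /le_trans; apply.
  by rewrite le_eqVlt; apply/predU1P; left; field.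
by rewrite !pmulr_rge0.
Qed.

(** Half the gradient of [|X b|^2]. *)
Let grad : 'cV[R]_p := X^T *m X *m b.

Lemma minimizer_gradE (j : 'I_p) (c : R) :
  ((X *m b)^T *m (X *m (c *: delta_mx j 0 : 'cV_p))) 0 0 = c * grad j 0.
Proof.
rewrite -!scalemxAr mxE; congr (_ * _).
set d : 'cV[R]_p := delta_mx j 0.
have -> : (X *m b)^T *m (X *m d) = grad^T *m d.
  by rewrite /grad !trmx_mul trmxK !mulmxA.
by rewrite /d -colE !mxE.
Qed.

Lemma minimizer_grad_coord (j : 'I_p) (c a : R) :
  (forall e, 0 < e -> e <= 1 ->
     e * a <= if j \in S then `|b j 0 + e * c| - `|b j 0|
              else `|b j 0| - `|b j 0 + e * c|) ->
  m * a <= c * grad j 0.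
Proof.
move=> H; rewrite -minimizer_gradE; apply: minimizer_first_order => e e0 e1.
rewrite scalerA l1gap_coord; have -> : l1gap S b = 1 by exact: hb.1.
by rewrite lerD2l; exact: H.
Qed.

(** The sign of [b j 0] is a subgradient of the absolute value there; the directions 1 and -1 give
    the two inequalities. *)
Lemma minimizer_grad_in (j : 'I_p) : j \in S -> b j 0 != 0 ->
  grad j 0 = m * Num.sg (b j 0).
Proof.
move=> jS bj.
have sgs : Num.sg (b j 0) * b j 0 = `|b j 0| by rewrite -normrEsg.
have sg1 : `|Num.sg (b j 0)| = 1 by rewrite normr_sg bj.
have gap x : Num.sg (b j 0) * x <= `|b j 0 + x| - `|b j 0|.
  rewrite lerBrDl -sgs -mulrDr (le_trans (ler_norm _))//.
  by rewrite normrM sg1 mul1r.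
apply/eqP; rewrite eq_le; apply/andP; split.
  have : m * - Num.sg (b j 0) <= -1 * grad j 0.
    apply: minimizer_grad_coord => e _ _; rewrite jS.
    by apply: le_trans (gap _); rewrite mulrN1 mulrN mulrN mulrC.
  by rewrite mulN1r mulrN lerN2.
rewrite -[grad _ _]mul1r; apply: minimizer_grad_coord => e _ _; rewrite jS.
by apply: le_trans (gap _); rewrite mulr1 mulrC.
Qed.

(** A move by [e] in either direction lowers the gap by at most [e]. *)
Lemma minimizer_grad_le (j : 'I_p) : j \notin S -> `|grad j 0| <= m.
Proof.
move=> /negPf jS.
have grad_le c : `|c| = 1 -> m * -1 <= c * grad j 0.
  move=> c1; apply: minimizer_grad_coord => e e0 _; rewrite jS.
  rewrite mulrN1 lerBrDl lerBlDr (le_trans (ler_normD _ _))//.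
  by rewrite normrM c1 mulr1 gtr0_norm.
have := grad_le 1 (normr1 _); have := grad_le (-1) (normrN1 _).
rewrite mul1r mulN1r mulrN1 lerN2 => ? ?.
by rewrite ler_norml; apply/andP.
Qed.

Lemma minimizer_grad_notin (j : 'I_p) : j \notin S ->
  grad j 0 * b j 0 = - (m * `|b j 0|).
Proof.
move=> jS; have gm := minimizer_grad_le jS.
apply/eqP; rewrite eq_le; apply/andP; split; last first.
  by rewrite lerNl (le_trans (ler_norm _))// normrN normrM ler_wpM2r.
(* Shrink [b j 0] towards 0, in direction [c = - b j 0]: for [e <= 1] the gap grows by exactly [e]
   times its absolute value. *)
rewrite lerNr [grad _ _ * _]mulrC -mulNr; apply: minimizer_grad_coord => e e0 e1.
rewrite (negPf jS) mulrN -[X in `|X - _|]mul1r -mulrBl normrM.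
rewrite ger0_norm ?subr_ge0// mulrBl mul1r; lra.
Qed.
End Minimizer.

Theorem theorem5p1 (R : realType) (n p : nat) (X : 'M[R]_(n, p))
  (beta0 : 'cV[R]_p) (lambda : R) (bstar : 'cV[R]_p)
  (hS0 : (0 < #|active_set beta0|)%N)
  (hlambda : 0 < lambda)
  (hkappa : 0 < compat2 X (active_set beta0))
  (hbstar : argmin (fun b : 'cV[R]_p => l2norm (X *m b))
              (compat_set (active_set beta0)) bstar)
  (hbetamin : forall j : 'I_p, j \in active_set beta0 ->
     Num.sg (bstar j 0) * bstar j 0 * #|active_set beta0|%:R
       / compat2 X (active_set beta0) * (lambda / n%:R)
     < Num.sg (bstar j 0) * beta0 j 0) :
  exists betastar zetastar : 'cV[R]_p,
    [/\ X^T *m X *m (betastar - beta0) + lambda *: zetastar = 0,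
        subdiff_l1 betastar zetastar
      & l2norm (X *m (betastar - beta0)) ^+ 2
        = #|active_set beta0|%:R / compat2 X (active_set beta0)
          * (lambda ^+ 2 / n%:R)].
Proof.
set S := active_set beta0 in hS0 hkappa hbstar hbetamin *.
have kE := compat2_minimizer hbstar; rewrite kE in hkappa hbetamin *.
set m := l2norm (X *m bstar) ^+ 2 in hkappa hbetamin kE *.
have s0 : 0 < #|S|%:R :> R by rewrite ltr0n.
(* As the inverse of 0 is 0, [n = 0] would make the compatibility constant vanish. *)
have n0 : 0 < n%:R :> R.
  rewrite lt0r ler0n andbT; apply: contraTneq hkappa => ->.
  by rewrite invr0 mulr0 ltxx.
have m0 : 0 < m.
  by move: hkappa; rewrite pmulr_lgt0 ?invr_gt0// pmulr_rgt0.
pose t := lambda / m; have t0 : 0 < t by exact: divr_gt0.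
(* Since the compatibility constant is [#|S| m / n], the factor in the betamin condition collapses
   to [t]. *)
have betamin j : j \in S ->
    t * (Num.sg (bstar j 0) * bstar j 0) < Num.sg (bstar j 0) * beta0 j 0.
  move=> /hbetamin; congr (_ < _); rewrite /t; field.
  by rewrite !gt_eqF.
(* At [bstar j 0 = 0] the sign is 0 and the condition would read [0 < 0]. *)
have bS j : j \in S -> bstar j 0 != 0.
  by move=> /betamin; apply: contraTneq => ->; rewrite sgr0 !(mul0r,mulr0) ltxx.
pose grad := X^T *m X *m bstar.
have grad_in j : j \in S -> grad j 0 = m * Num.sg (bstar j 0).
  by move=> jS; exact: (minimizer_grad_in hbstar jS (bS j jS)).
have grad_notin j : j \notin S -> grad j 0 * bstar j 0 = - (m * `|bstar j 0|).
  exact: (minimizer_grad_notin hbstar).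
have grad_le j : `|grad j 0| <= m.
  have [jS|jS] := boolP (j \in S); last exact: (minimizer_grad_le hbstar).
  by rewrite grad_in// normrM normr_sg bS// mulr1 gtr0_norm.
have diffE : beta0 - t *: bstar - beta0 = - t *: bstar.
  by rewrite addrAC subrr add0r scaleNr.
exists (beta0 - t *: bstar), (m^-1 *: grad); split.
- by rewrite diffE -scalemxAr scalerA -/t -scalerDl addNr scale0r.
- split.
    rewrite mxE; apply: eq_bigr => j _.
    rewrite [_^T _ _]mxE [(_ *: grad) _ _]mxE.
    have -> : (beta0 - t *: bstar) j 0 = beta0 j 0 - t * bstar j 0.
      by rewrite !mxE.
    have [jS|jS] := boolP (j \in S).
      rewrite grad_in// mulKf ?gt_eqF//.
      set x := _ - _.
      (* By betamin, entry [x] of the solution keeps the sign of [bstar j 0]. *)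
      have x0 : 0 < Num.sg (bstar j 0) * x.
        by rewrite mulrBr mulrCA subr_gt0 betamin.
      by rewrite -(gtr0_norm x0) normrM normr_sg bS// mul1r.
    have -> : beta0 j 0 = 0 by move: jS; rewrite inE negbK => /eqP.
    rewrite sub0r normrN normrM (gtr0_norm t0).
    transitivity (- (t / m) * (grad j 0 * bstar j 0)); first by ring.
    by rewrite grad_notin//; field; rewrite gt_eqF.
  rewrite mx_normrE; apply: bigmax_le => // -[i k] _ /=.
  rewrite ord1 mxE normrM normfV (gtr0_norm m0) mulrC ler_pdivrMr//.
  by rewrite mul1r.
(* Both sides equal [t^2 m = lambda^2 / m]. *)
- rewrite diffE -scalemxAr sqr_l2normZ -/m /t; field.
  by rewrite !gt_eqF.
Qed.
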